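(* Let $I$ be an ideal of $R=\mathsf k[x_1,\dots,x_n]$ minimally generated by $q\ge1$ monomials $m_1,\ldots,m_q$ (not necessarily square-free), and let $\mathcal{D}\subseteq[q]\times(2^{[q]}\smallsetminus\{\emptyset\})$ be a set of divisibility relations with $\mathcal{D}\subseteq{\sf Div}(I)$. Then there exists a map $f:\mathrm{LCM}(\mathcal{E}_{\mathcal{D}})\to\mathrm{LCM}(I)$ that is bijective on the atoms, preserves lcms (joins), and such that, if $\mathbf F_{\mathcal{D}}$ is the minimal multigraded free resolution of $\mathcal{E}_{\mathcal{D}}$, the relabeled complex $f(\mathbf F_{\mathcal{D}})$ is a multigraded free resolution of $I$. Furthermore, if $\overline{\mathcal{D}}={\sf Div}(I)$, then $f$ is an isomorphism of lattices, $f(\mathbf F_{\mathcal{D}})$ is the minimal multigraded free resolution of $I$, and in particular $\beta_i(\mathcal{E}_{\mathcal{D}})=\beta_i(I)$ for all $i\ge0$.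
   Context: Divisibility relations. For monomials $U=\{u_i:i\in\Lambda\}$ indexed by a finite set $\Lambda$ (with $u_i=u_j\Rightarrow i=j$), a divisibility relation is a pair $(b,B)$, $b\in\Lambda$, $\emptyset\ne B\subseteq\Lambda$, with $u_b\mid\mathrm{lcm}(u_i:i\in B)$; ${\sf Div}(U)$ is the set of these. ${\sf Div}(I)={\sf Div}(\{m_1,\dots,m_q\})$ with $\Lambda=[q]$ and the given ordering of the minimal generators. $(b,B)$ is trivial if $b\in B$; $(b,B)^{\sf ex}=\{(b,C):B\subseteq C\subseteq\Lambda\}$; $(b,B)\circ(c,C)=(b,(B\smallsetminus\{c\})\cup C)$. For $\mathcal{D}\subseteq\Lambda\times2^\Lambda$: $\mathcal{D}^\circ$ is the set of all compositions $(b_1,B_1)\circ\cdots\circ(b_s,B_s)$, $s\ge1$, $(b_i,B_i)\in\mathcal{D}$, with all possible bracketings; $\mathcal{D}^{\sf ex}=\bigcup_{(b,B)\in\mathcal{D}}(b,B)^{\sf ex}$; $\Lambda^{\sf triv}=\{(b,B):b\in B\}$; $\overline{\mathcal{D}}=(\mathcal{D}^\circ)^{\sf ex}\cup\Lambda^{\sf triv}$. $\mathcal{D}$-extremal ideals. $S_{[q]}=\mathsf k[y_A:\emptyset\ne A\subseteq[q]]$; $Q(\mathcal{D})=\{A\subseteq[q]: A\ne\emptyset,\ A\cap B\ne\emptyset \text{ for all }(b,B)\in\mathcal{D}\text{ with } b\in A\}$; $\varepsilon_{\mathcal{D},i}=\prod_{A\in Q(\mathcal{D}),\,i\in A}y_A$;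 $\mathcal{E}_{\mathcal{D}}=(\varepsilon_{\mathcal{D},1},\ldots,\varepsilon_{\mathcal{D},q})$. LCM lattice: for a monomial ideal $J$ with minimal monomial generators $g_1,\dots,g_q$, $\mathrm{LCM}(J)$ is the set of lcms of nonempty subsets of the $g_i$, ordered by divisibility; its atoms are the $g_i$ and its join is lcm. Relabeling (Gasharov–Peeva–Welker): given $f:\mathrm{LCM}(J)\to\mathrm{LCM}(J')$ and a minimal multigraded free resolution $\mathbf F$ of $J$, whose free modules are sums of shifted copies $S(-\mathbf m)$ with $\mathbf m\in\mathrm{LCM}(J)$ and whose differentials have entries $c\cdot \mathbf m/\mathbf m'$ ($c\in\mathsf k$), $f(\mathbf F)$ is the complex over $R$ obtained by replacing each $S(-\mathbf m)$ by $R(-f(\mathbf m))$ and each entry $c\cdot\mathbf m/\mathbf m'$ by $c\cdot f(\mathbf m)/f(\mathbf m')$. $\beta_i(J)=\dim_{\mathsf k}\mathrm{Tor}_i(J,\mathsf k)$. *)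

(* Defs.v *)
From HB Require Import structures.
From mathcomp Require Import all_boot all_order all_algebra.
From mathcomp Require Import all_fingroup.
From mathcomp Require Import mpoly.

Set Implicit Arguments.
Unset Strict Implicit.
Unset Printing Implicit Defensive.

Import GRing.Theory.
Local Open Scope ring_scope.

Definition mdiv n (a b : 'X_{1..n}) : bool := [forall i, (a i <= b i)%N].

Definition monlcm n (a b : 'X_{1..n}) : 'X_{1..n} :=
  [multinom maxn (a i) (b i) | i < n].

Definition mlcm_over n q (g : 'I_q -> 'X_{1..n}) (S : {set 'I_q}) : 'X_{1..n} :=
  [multinom (\max_(l in S) g l i)%N | i < n].

Definition inLCM n q (g : 'I_q -> 'X_{1..n}) (a : 'X_{1..n}) : Prop :=
  exists S : {set 'I_q}, S != set0 /\ a = mlcm_over g S.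

Definition minimal_gens n q (g : 'I_q -> 'X_{1..n}) : Prop :=
  forall i j, i != j -> ~~ mdiv (g i) (g j).

Definition drel q := ('I_q * {set 'I_q})%type.

Definition Div n q (g : 'I_q -> 'X_{1..n}) (x : drel q) : Prop :=
  x.2 != set0 /\ mdiv (g x.1) (mlcm_over g x.2).

Definition dcomp q (x y : drel q) : drel q := (x.1, (x.2 :\ y.1) :|: y.2).

(* D^o : all compositions of elements of D, with all bracketings
   (= closure of D under binary composition) *)
Inductive dcirc q (D : {set drel q}) : drel q -> Prop :=
| dcirc_base x : x \in D -> dcirc D x
| dcirc_comp x y : dcirc D x -> dcirc D y -> dcirc D (dcomp x y).

Definition Dbar q (D : {set drel q}) (x : drel q) : Prop :=
  (exists B, dcirc D (x.1, B) /\ B \subset x.2) \/ x.1 \in x.2.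

(* D-extremal ideal in S_[q] = k[y_A : A nonempty subset of [q]]        *)

Definition nesub q := {A : {set 'I_q} | A != set0}.
Definition nE q : nat := #|{: nesub q}|.

Definition inQ q (D : {set drel q}) (A : {set 'I_q}) : bool :=
  (A != set0) && [forall x in D, (x.1 \in A) ==> (A :&: x.2 != set0)].

(* eps_{D,i} = prod_{A in Q(D), i in A} y_A ; the variable y_A has index
   enum_rank A in 'I_(nE q) *)
Definition eps q (D : {set drel q}) (i : 'I_q) : 'X_{1..nE q} :=
  [multinom (let A := val (@enum_val (nesub q) predT j) in
             nat_of_bool (inQ D A && (i \in A))) | j < nE q].

(* Multigraded free complexes, in monomial-matrix form.
   F_i = (+)_{j < rk i} S(-lab i j); the differential d_{i+1}: F_{i+1} -> F_i
   (row-vector convention) sends e_j to sum_l coef i j l * x^(lab (i+1) j - lab i l) e_l. *)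

Record mcomplex (k : fieldType) (n : nat) := MComplex {
  rk : nat -> nat;
  lab : forall i, 'I_(rk i) -> 'X_{1..n};
  coef : forall i, 'M[k]_(rk i.+1, rk i)
}.
Arguments rk {k n} _ i.
Arguments lab {k n} _ i j.
Arguments coef {k n} _ i.

Definition dmat (k : fieldType) n (F : mcomplex k n) (i : nat)
  : 'M[{mpoly k[n]}]_(rk F i.+1, rk F i) :=
  \matrix_(j, l) ((coef F i j l)%:MP * 'X_[mnm_sub (lab F i.+1 j) (lab F i l)]).

Definition graded (k : fieldType) n (F : mcomplex k n) : Prop :=
  forall i j l, coef F i j l != 0 -> mdiv (lab F i l) (lab F i.+1 j).

(* F is a multigraded free resolution of the ideal generated by g:
   exact in positive homological degrees, and there is a (degree-preserving)
   augmentation F_0 -> J, e_j |-> c_j x^(lab 0 j), onto J whose kernel is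
   the image of d_1. *)
Definition is_resolution (k : fieldType) n q (g : 'I_q -> 'X_{1..n})
  (F : mcomplex k n) : Prop :=
  graded F /\
  (forall i (v : 'rV[{mpoly k[n]}]_(rk F i.+1)),
      v *m dmat F i = 0 <-> exists w : 'rV_(rk F i.+2), v = w *m dmat F i.+1) /\
  exists c : 'I_(rk F 0) -> k,
    let aug : 'M[{mpoly k[n]}]_(rk F 0, 1) :=
      \matrix_(j, _) ((c j)%:MP * 'X_[lab F 0 j]) in
    (forall j, c j != 0 -> exists l, mdiv (g l) (lab F 0 j)) /\
    (forall v : 'rV[{mpoly k[n]}]_(rk F 0),
        v *m aug = 0 <-> exists w : 'rV_(rk F 1), v = w *m dmat F 0) /\
    (forall l, exists v : 'rV[{mpoly k[n]}]_(rk F 0), v *m aug = ('X_[g l])%:M).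

(* minimal: all entries of the differentials lie in the maximal ideal *)
Definition is_minimal_resolution (k : fieldType) n q (g : 'I_q -> 'X_{1..n})
  (F : mcomplex k n) : Prop :=
  is_resolution g F /\
  forall i j l, coef F i j l != 0 -> lab F i.+1 j != lab F i l.

Definition relabel (k : fieldType) n m (f : 'X_{1..n} -> 'X_{1..m})
  (F : mcomplex k n) : mcomplex k m :=
  @MComplex k m (rk F) (fun i j => f (lab F i j)) (coef F).

(* Betti numbers: beta_i(J) = dim_k Tor_i(J,k) = dim_k H_i(F (x) k) for a free
   resolution F of J.  F (x) k has scalar differentials: entry coef if the
   labels agree, 0 otherwise. *)
Definition redmat (k : fieldType) n (F : mcomplex k n) (i : nat)
  : 'M[k]_(rk F i.+1, rk F i) :=
  \matrix_(j, l) (if lab F i.+1 j == lab F i l then coef F i j l else 0).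

Definition homdim (k : fieldType) n (F : mcomplex k n) (i : nat) : nat :=
  (rk F i - (if i is i'.+1 then \rank (redmat F i') else 0) - \rank (redmat F i))%N.

Definition betti (k : fieldType) n q (g : 'I_q -> 'X_{1..n}) (i b : nat) : Prop :=
  exists F : mcomplex k n, is_resolution g F /\ homdim F i = b.

(* Main.v *)
(* For a monomial x let S(x) be the set of generators of E_D dividing x, and let
   f(x) be the lcm of the generators of I indexed by S(x).  A multigraded complex
   F resolves an ideal iff, for every monomial b, its strand at b (the span of
   the basis elements whose label divides b) is exact over k.  The strand of the
   relabeled complex at c is the part of F over the downset {x : f(x) | c},
   which contains some a with lcm S(x) | a for all its members x; stripping off
   the labels not dividing a reduces its exactness to that of the strand at a.

   The same principle shows that labels outside the lcm lattice carry no
   homology.  Hence they do not occur in a minimal resolution.  For an arbitrary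
   resolution F and f an isomorphism, it shows that the reduced differentials of
   F and f(F) have the same ranks, so the Betti numbers agree without comparing
   two resolutions of the same ideal. *)
Require Import Defs.
From HB Require Import structures.
From mathcomp Require Import all_boot all_order all_algebra all_fingroup.
From mathcomp Require Import mpoly.

Set Implicit Arguments.
Unset Strict Implicit.
Unset Printing Implicit Defensive.

Import GRing.Theory.

(** * Monomials *)

Section Divisibility.
Variables n q : nat.
Implicit Types a b c : 'X_{1..n}.
Implicit Types g : 'I_q -> 'X_{1..n}.

Lemma mdivE a b : mdiv a b = (a <= b)%MM.
Proof. by []. Qed.

Lemma mdivP a b : reflect (forall i, (a i <= b i)%N) (mdiv a b).
Proof. exact: forallP. Qed.

Lemma mdiv_refl a : mdiv a a.
Proof. exact: lepm_refl. Qed.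

Lemma mdiv_trans b a c : mdiv a b -> mdiv b c -> mdiv a c.
Proof. exact: lepm_trans. Qed.

Lemma mdiv_anti a b : mdiv a b -> mdiv b a -> a = b.
Proof.
move=> /mdivP ab /mdivP ba; apply/mnmP=> i.
by apply/eqP; rewrite eqn_leq ab ba.
Qed.

Lemma mdiv0m a : mdiv 0%MM a.
Proof. by apply/mdivP=> i; rewrite mnmE. Qed.

Lemma mdivm0 a : mdiv a 0%MM -> a = 0%MM.
Proof. by move=> h; apply: mdiv_anti h (mdiv0m a). Qed.

Lemma mdiv_mdeg_eq a b : mdiv a b -> (mdeg b <= mdeg a)%N -> a = b.
Proof.
move=> ab; rewrite -(submK ab) mdegD -{2}[mdeg a]add0n leq_add2r leqn0.
by rewrite mdeg_eq0 => /eqP ->; rewrite add0m.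
Qed.

Lemma mlcm_overP g (S : {set 'I_q}) c :
  reflect (forall l, l \in S -> mdiv (g l) c) (mdiv (mlcm_over g S) c).
Proof.
apply: (iffP (mdivP _ _)) => [h l lS | h i].
  apply/mdivP=> i; apply: leq_trans (h i); rewrite mnmE.
  exact: (leq_bigmax_cond (F := fun l : 'I_q => g l i)) lS.
by rewrite mnmE; apply/bigmax_leqP=> l /h/mdivP.
Qed.

Lemma mdiv_mlcm g (S : {set 'I_q}) l : l \in S -> mdiv (g l) (mlcm_over g S).
Proof. by move=> lS; apply: (mlcm_overP g S _ (mdiv_refl _)). Qed.

Lemma mlcm_over0 g : mlcm_over g set0 = 0%MM.
Proof. by apply: mdivm0; apply/mlcm_overP=> l; rewrite inE. Qed.

Lemma mlcm_over1 g l : mlcm_over g [set l] = g l.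
Proof.
apply: mdiv_anti; last by apply: mdiv_mlcm; rewrite inE.
by apply/mlcm_overP=> j; rewrite inE => /eqP ->; apply: mdiv_refl.
Qed.

Lemma mdiv_mlcmS g (S T : {set 'I_q}) :
  S \subset T -> mdiv (mlcm_over g S) (mlcm_over g T).
Proof. by move=> /subsetP ST; apply/mlcm_overP=> l /ST; apply: mdiv_mlcm. Qed.

Lemma mdiv_monlcm a b c : mdiv (monlcm a b) c = mdiv a c && mdiv b c.
Proof.
apply/mdivP/andP => [h | [/mdivP ha /mdivP hb] i]; last first.
  by rewrite mnmE geq_max ha hb.
by split; apply/mdivP=> i; move: (h i); rewrite mnmE geq_max => /andP[].
Qed.

Lemma mlcm_overU g (S T : {set 'I_q}) :
  mlcm_over g (S :|: T) = monlcm (mlcm_over g S) (mlcm_over g T).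
Proof.
apply: mdiv_anti.
  have := mdiv_refl (monlcm (mlcm_over g S) (mlcm_over g T)).
  rewrite {1}mdiv_monlcm => /andP[/mlcm_overP hS /mlcm_overP hT].
  by apply/mlcm_overP=> l; rewrite inE => /orP[/hS | /hT].
by rewrite mdiv_monlcm !mdiv_mlcmS ?subsetUl ?subsetUr.
Qed.

End Divisibility.

(** * Strands of multigraded complexes *)

Section Strands.
Variables (k : fieldType) (n : nat).
Implicit Types b : 'X_{1..n}.
Local Open Scope ring_scope.

(** Generalizes [dmat] to cover the augmentation as well, whose single target label is the monomial
    1. *)
Definition gmat r s (A : 'M[k]_(r, s)) (la : 'I_r -> 'X_{1..n})
    (lb : 'I_s -> 'X_{1..n}) : 'M[{mpoly k[n]}]_(r, s) :=
  \matrix_(j, l) ((A j l)%:MP * 'X_[mnm_sub (la j) (lb l)]).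

Definition gradedmx r s (A : 'M[k]_(r, s)) (la : 'I_r -> 'X_{1..n})
    (lb : 'I_s -> 'X_{1..n}) :=
  forall j l, A j l != 0 -> mdiv (lb l) (la j).

Definition supp (U : pred 'X_{1..n}) r (la : 'I_r -> 'X_{1..n}) (v : 'rV[k]_r) :=
  forall j, v 0 j != 0 -> U (la j).

Definition divs b : pred 'X_{1..n} := fun x => mdiv x b.

(** [slift] embeds the span of the labels dividing b as the homogeneous elements of degree b;
    [scomp] extracts the component of degree b. The truncated [mnm_sub] is a true quotient only if
    the label divides b, hence the test in [scomp]. *)
Definition slift b r (la : 'I_r -> 'X_{1..n}) (v : 'rV[k]_r) :
    'rV[{mpoly k[n]}]_r :=
  \row_j ((v 0 j)%:MP * 'X_[mnm_sub b (la j)]).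

Definition scomp b r (la : 'I_r -> 'X_{1..n}) (V : 'rV[{mpoly k[n]}]_r) :
    'rV[k]_r :=
  \row_j (if mdiv (la j) b then (V 0 j)@_(mnm_sub b (la j)) else 0).

Lemma mcoeffMXE (p : {mpoly k[n]}) a b :
  (p * 'X_[a])@_b = if mdiv a b then p@_(b - a) else 0.
Proof.
have [ab | nab] := boolP (mdiv a b).
  by rewrite -{1}(submK ab) addmC mcoeffMX.
rewrite mcoeffM big1 // => -[x y] /eqP /= bE; rewrite mcoeffX.
have [ay | _] := eqVneq a y; last by rewrite mulr0.
by case/negP: nab; rewrite bE ay mdivE lem_addl.
Qed.

Lemma mnm_subA (x y z : 'X_{1..n}) :
  mdiv z y -> mdiv y x -> (x - y + (y - z) = x - z)%MM.
Proof.
move=> /mdivP zy /mdivP yx; apply/mnmP=> i; rewrite !(mnmBE, mnmDE).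
by rewrite addnBA // subnK.
Qed.

Lemma slift_gmat b r s (A : 'M[k]_(r, s)) la lb (v : 'rV[k]_r) :
  gradedmx A la lb -> supp (divs b) la v ->
  slift b la v *m gmat A la lb = slift b lb (v *m A).
Proof.
move=> gA sv; apply/rowP=> l; rewrite !mxE rmorph_sum mulr_suml.
apply: eq_bigr => j _; rewrite !mxE mulrACA -rmorphM -mpolyXD.
have [->|/sv bj] := eqVneq (v 0 j) 0; first by rewrite mul0r !rmorph0 !mul0r.
have [->|/gA jl] := eqVneq (A j l) 0; first by rewrite mulr0 !rmorph0 !mul0r.
by rewrite mnm_subA.
Qed.

Lemma scomp_gmat b r s (A : 'M[k]_(r, s)) la lb (V : 'rV[{mpoly k[n]}]_r) :
  gradedmx A la lb -> scomp b lb (V *m gmat A la lb) = scomp b la V *m A.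
Proof.
move=> gA; apply/rowP=> l; rewrite !mxE.
under eq_bigr do rewrite !mxE (mulrCA (V 0 _)).
rewrite raddf_sum /=.
under eq_bigr do rewrite mcoeffCM mcoeffMXE.
case: ifPn => [lb_b | nlb].
  apply: eq_bigr => j _; rewrite mxE mulrC.
  have [->|/gA jl] := eqVneq (A j l) 0; first by rewrite !mulr0.
  have -> : mdiv (la j - lb l)%MM (b - lb l)%MM = mdiv (la j) b.
    apply/mdivP/mdivP=> h i; move: (h i); rewrite !mnmBE;
    move/mdivP/(_ i): lb_b; move/mdivP/(_ i): jl => jl lb_b.
      by rewrite leq_sub2rE.
    by move=> le; rewrite leq_sub2r.
  case: ifP => // jb; congr (_@__ * _); apply/mnmP=> i; rewrite !mnmBE.
  move/mdivP/(_ i): jb => jb; move/mdivP/(_ i): jl => jl.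
  by rewrite subnBA // subnK // (leq_trans jl).
rewrite big1 // => j _; rewrite mxE; case: ifPn => jb; last by rewrite mul0r.
have [->|/gA jl] := eqVneq (A j l) 0; first by rewrite !mulr0.
by case/negP: nlb; apply: mdiv_trans jl jb.
Qed.

Lemma supp_scomp b r (la : 'I_r -> 'X_{1..n}) V : supp (divs b) la (scomp b la V).
Proof. by move=> j; rewrite mxE /divs; case: ifP; rewrite ?eqxx. Qed.

Lemma scompK b r (la : 'I_r -> 'X_{1..n}) v :
  supp (divs b) la v -> scomp b la (slift b la v) = v.
Proof.
move=> sv; apply/rowP=> j; rewrite !mxE mcoeffCM mcoeffX eqxx mulr1.
by case: ifPn => // nb; have [//|/sv] := eqVneq (v 0 j) 0; rewrite /divs (negPf nb).
Qed.

Lemma slift0 b r (la : 'I_r -> 'X_{1..n}) : slift b la 0 = 0.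
Proof. by apply/rowP=> j; rewrite !mxE rmorph0 mul0r. Qed.

Lemma scomp0 b r (la : 'I_r -> 'X_{1..n}) : scomp b la 0 = 0.
Proof. by apply/rowP=> j; rewrite !mxE mcoeff0 if_same. Qed.

Lemma slift_comp_sum r (la : 'I_r -> 'X_{1..n}) (V : 'rV[{mpoly k[n]}]_r) :
  exists s : seq 'X_{1..n}, V = \sum_(b <- s) slift b la (scomp b la V).
Proof.
(* All multidegrees of terms of V; [undup] makes each homogeneous component count once. *)
exists (undup (flatten [seq [seq (x + la j)%MM | x <- msupp (V 0 j)]
                       | j <- enum 'I_r])).
set s := undup _; apply/rowP=> j; rewrite summxE.
apply/mpolyP => x; rewrite raddf_sum /=.
under eq_bigr do rewrite !mxE mcoeffCM mcoeffX.
have [xs | nxs] := boolP ((x + la j)%MM \in s); last first.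
  rewrite memN_msupp_eq0 ?big1_seq //; last first.
    apply: contra nxs => xs; rewrite mem_undup; apply/flattenP.
    exists [seq (x + la j)%MM | x <- msupp (V 0 j)].
      by apply: (map_f (fun j => [seq (x + la j)%MM | x <- msupp (V 0 j)]));
         rewrite mem_enum.
    exact: (map_f (fun x => (x + la j)%MM)).
  move=> b /= bs; case: ifPn => [jb|]; last by rewrite mul0r.
  have [e | _] := eqVneq (b - la j)%MM x; last by rewrite mulr0.
  by case/negP: nxs; rewrite -e submK.
rewrite (bigD1_seq _ xs (undup_uniq _)) /= addmK eqxx mulr1.
rewrite [mdiv _ _]lem_addl big1 ?addr0 // => b bx.
case: ifPn => [jb|]; last by rewrite mul0r.
have [e | _] := eqVneq (b - la j)%MM x; last by rewrite mulr0.
by case/negP: bx; rewrite -e submK.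
Qed.

Lemma gmatM r s t (A : 'M[k]_(r, s)) (B : 'M[k]_(s, t)) la lb lc :
  gradedmx A la lb -> gradedmx B lb lc ->
  gmat A la lb *m gmat B lb lc = gmat (A *m B) la lc.
Proof.
move=> gA gB; apply/matrixP=> j l; rewrite !mxE rmorph_sum mulr_suml.
apply: eq_bigr => i _; rewrite !mxE mulrACA -rmorphM -mpolyXD.
have [->|/gA ji] := eqVneq (A j i) 0; first by rewrite mul0r !rmorph0 !mul0r.
have [->|/gB il] := eqVneq (B i l) 0; first by rewrite mulr0 !rmorph0 !mul0r.
by rewrite mnm_subA.
Qed.

Lemma gmat_eq0 r s (A : 'M[k]_(r, s)) la lb : gmat A la lb = 0 -> A = 0.
Proof.
move=> /matrixP A0; apply/matrixP=> j l.
move: (A0 j l) => /(congr1 (mcoeff (la j - lb l)%MM)).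
by rewrite !mxE mcoeffCM mcoeffX eqxx mulr1 mcoeff0.
Qed.

Lemma gmat0 r s la lb : gmat (0 : 'M[k]_(r, s)) la lb = 0.
Proof. by apply/matrixP=> j l; rewrite !mxE rmorph0 mul0r. Qed.

Definition exact_at (U : pred 'X_{1..n}) r s t (A : 'M[k]_(r, s))
    (B : 'M[k]_(s, t)) (la : 'I_r -> 'X_{1..n}) (lb : 'I_s -> 'X_{1..n}) :=
  forall v : 'rV[k]_s, supp U lb v -> v *m B = 0 ->
    exists w : 'rV[k]_r, supp U la w /\ v = w *m A.

(* Multigraded exactness can be tested on the strands of multidegree b, which
   are spanned by the basis elements whose label divides b. *)
Lemma gmat_exactP r s t (A : 'M[k]_(r, s)) (B : 'M[k]_(s, t)) la lb lc :
  gradedmx A la lb -> gradedmx B lb lc ->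
  (forall v : 'rV_s, v *m gmat B lb lc = 0 <->
     exists w : 'rV_r, v = w *m gmat A la lb) <->
  (A *m B = 0 /\ forall b, exact_at (divs b) A B la lb).
Proof.
move=> gA gB; split=> [ex | [AB ex] V].
  split.
    apply: (@gmat_eq0 _ _ _ la lc); rewrite -(gmatM gA gB).
    apply/row_matrixP=> j; rewrite row_mul row0; apply/ex.
    by exists (delta_mx 0 j); rewrite rowE.
  move=> b v sv vB.
  have /ex[W WE] : slift b lb v *m gmat B lb lc = 0.
    by rewrite slift_gmat // vB slift0.
  exists (scomp b la W); split; first exact: supp_scomp.
  by rewrite -(scomp_gmat b W gA) -WE scompK.
split=> [VB | [W ->]]; last by rewrite -mulmxA (gmatM gA gB) AB gmat0 mulmx0.
have [s0 ->] := slift_comp_sum lb V; elim/big_ind: _ => [|v1 v2 [w1 ->] [w2 ->]|b _].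
- by exists 0; rewrite mul0mx.
- by exists (w1 + w2); rewrite mulmxDl.
have [||w [sw ->]] := ex b (scomp b lb V).
- exact: supp_scomp.
- by rewrite -(scomp_gmat b V gB) VB scomp0.
by exists (slift b la w); rewrite slift_gmat.
Qed.

End Strands.

(** * Resolutions described by their strands *)

Section StrandResolution.
Variables (k : fieldType) (n q : nat).
Implicit Types (g : 'I_q -> 'X_{1..n}) (F : mcomplex k n).
Local Open Scope ring_scope.

(** The augmentation is treated as the differential out of degree 0, with one-dimensional target
    over k, so that [dout] covers all degrees uniformly. *)
Definition dim_out F i : nat := if i is i'.+1 then rk F i' else 1.

Definition dout F (c : 'cV[k]_(rk F 0)) i : 'M[k]_(rk F i, dim_out F i) :=
  match i return 'M[k]_(rk F i, dim_out F i) with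
  | 0 => c
  | i'.+1 => coef F i'
  end.

Record strand_resolution g F (c : 'cV[k]_(rk F 0)) : Prop := StrandResolution {
  sr_graded : graded F;
  sr_aug : forall j, c j 0 != 0 -> exists l, mdiv (g l) (lab F 0 j);
  sr_complex : forall i, coef F i *m dout c i = 0;
  sr_exact : forall i b,
    exact_at (divs b) (coef F i) (dout c i) (@lab _ _ F i.+1) (@lab _ _ F i);
  sr_onto : forall l,
    exists v, supp (divs (g l)) (@lab _ _ F 0) v /\ v *m c = 1%:M
}.

(** Target label 1 for the augmentation makes exactness in degree 0 an instance of [gmat_exactP].
    Surjectivity is compared in multidegree [g l], where the generator becomes the scalar 1. *)
Lemma is_resolutionP g F :
  is_resolution g F <-> exists c : 'cV_(rk F 0), strand_resolution g c.
Proof.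
have zero_graded (c : 'cV[k]_(rk F 0)) :
    gradedmx c (@lab _ _ F 0) (fun=> 0%MM) by move=> j l _; apply: mdiv0m.
have augE (c : 'cV[k]_(rk F 0)) : gmat c (@lab _ _ F 0) (fun=> 0%MM) =
    \matrix_(j, _) ((c j 0)%:MP * 'X_[lab F 0 j]).
  by apply/matrixP=> j l; rewrite !mxE subm0 (ord1 l).
have oneE l : slift (g l) (fun=> 0%MM) (1%:M : 'M[k]_1) = ('X_[g l])%:M.
  by apply/rowP=> j; rewrite !mxE subm0 (ord1 j) eqxx rmorph1 mul1r mulr1n.
split=> [[grF [exF [c [augF [ex0 onto]]]]] | [c [grF augF cF exF onto]]].
  pose c' : 'cV[k]_(rk F 0) := \col_j c j.
  have augE' : (\matrix_(j, _) ((c j)%:MP * 'X_[lab F 0 j]) : 'cV_(rk F 0)) =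
      gmat c' (@lab _ _ F 0) (fun=> 0%MM).
    by rewrite augE; apply/matrixP=> j l; rewrite !mxE.
  rewrite augE' in ex0 onto.
  have [cx0 ex0'] := (gmat_exactP (grF 0) (zero_graded c')).1 ex0.
  exists c'; split=> //.
  - by move=> j; rewrite mxE => /augF.
  - by case=> [|i] //; have [] := (gmat_exactP (grF i.+1) (grF i)).1 (exF i).
  - by case=> [|i] //; have [] := (gmat_exactP (grF i.+1) (grF i)).1 (exF i).
  move=> l; have [v vE] := onto l; exists (scomp (g l) (@lab _ _ F 0) v).
  split; first exact: supp_scomp.
  rewrite -(scomp_gmat _ _ (zero_graded c')) vE -oneE scompK // => j _.
  exact: mdiv0m.
split=> //; split=> [i|].
  by apply/(gmat_exactP (grF i.+1) (grF i)); split; [exact: cF i.+1 | exact: exF i.+1].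
exists (fun j => c j 0); rewrite /= -augE; split=> //; split=> [|l].
  apply/(gmat_exactP (grF 0) (zero_graded c)).
  by split; [exact: cF 0%N | exact: exF 0%N].
have [v [sv vc]] := onto l; exists (slift (g l) (@lab _ _ F 0) v).
by rewrite slift_gmat // vc oneE.
Qed.

End StrandResolution.

(** * Acyclicity over downsets *)

Section Closure.
Variables n q : nat.
Implicit Types (a b x y : 'X_{1..n}) (g : 'I_q -> 'X_{1..n}).

Definition gens_below g b : {set 'I_q} := [set l | mdiv (g l) b].

Definition lcm_below g b : 'X_{1..n} := mlcm_over g (gens_below g b).

Definition downset (U : pred 'X_{1..n}) := forall x y, mdiv x y -> U y -> U x.

(** The member [a] is divisible by every generator that divides some member of U, so it replaces the
    maximum that [divs b] has. *)
Definition topped g (U : pred 'X_{1..n}) :=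
  exists a, U a /\ forall x, U x -> mdiv (lcm_below g x) a.

Lemma gens_belowS g a b : mdiv a b -> gens_below g a \subset gens_below g b.
Proof. by move=> ab; apply/subsetP=> l; rewrite !inE => /mdiv_trans; apply. Qed.

Lemma gens_below_mid g x y z : mdiv x y -> mdiv y z ->
  gens_below g x = gens_below g z -> gens_below g y = gens_below g x.
Proof. by move=> xy yz xz; apply/eqP; rewrite eqEsubset {1}xz !gens_belowS. Qed.

Lemma lcm_below_mdiv g b : mdiv (lcm_below g b) b.
Proof. by apply/mlcm_overP=> l; rewrite inE. Qed.

Lemma lcm_belowS g a b : mdiv a b -> mdiv (lcm_below g a) (lcm_below g b).
Proof. by move=> ab; apply/mdiv_mlcmS/gens_belowS. Qed.

Lemma gens_below_lcm g b : gens_below g (lcm_below g b) = gens_below g b.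
Proof.
apply/eqP; rewrite eqEsubset gens_belowS ?lcm_below_mdiv //=.
by apply/subsetP=> l lb; rewrite inE mdiv_mlcm.
Qed.

Definition sdivs b : pred 'X_{1..n} := fun x => mdiv x b && (x != b).

Lemma downset_divs b : downset (divs b).
Proof. by move=> x y; apply: mdiv_trans. Qed.

Lemma downset_sdivs b : downset (sdivs b).
Proof.
move=> x y xy /andP[yb nyb]; rewrite /sdivs (mdiv_trans xy yb).
by apply: contra nyb => /eqP xb; rewrite -xb in yb *; rewrite (mdiv_anti xy yb).
Qed.

Lemma topped_sdivs g b : lcm_below g b != b -> topped g (sdivs b).
Proof.
move=> nb; exists (lcm_below g b); rewrite /sdivs lcm_below_mdiv nb; split=> // x.
by case/andP=> xb _; apply: lcm_belowS.
Qed.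

End Closure.

Section Acyclicity.
Variables (k : fieldType) (n q : nat) (g : 'I_q -> 'X_{1..n}).
Variables (F : mcomplex k n) (c : 'cV[k]_(rk F 0)).
Hypothesis res : strand_resolution g c.
Implicit Types (U : pred 'X_{1..n}) (a b x y : 'X_{1..n}).
Local Open Scope ring_scope.
Local Notation lb i := (@lab _ _ F i).

Lemma supp0 U r (la : 'I_r -> 'X_{1..n}) : supp U la (0 : 'rV[k]_r).
Proof. by move=> j; rewrite mxE eqxx. Qed.

Lemma suppD U r (la : 'I_r -> 'X_{1..n}) (v w : 'rV[k]_r) :
  supp U la v -> supp U la w -> supp U la (v + w).
Proof.
move=> sv sw j; rewrite mxE; have [v0|/sv //] := eqVneq (v 0 j) 0.
by rewrite v0 add0r => /sw.
Qed.

Lemma suppN U r (la : 'I_r -> 'X_{1..n}) (v : 'rV[k]_r) :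
  supp U la v -> supp U la (- v).
Proof. by move=> sv j; rewrite mxE oppr_eq0 => /sv. Qed.

Lemma supp_sub U U' r (la : 'I_r -> 'X_{1..n}) (v : 'rV[k]_r) :
  (forall x, U x -> U' x) -> supp U la v -> supp U' la v.
Proof. by move=> UU' sv j /sv /UU'. Qed.

Lemma mulmx_neq0 r s (v : 'rV[k]_r) (A : 'M[k]_(r, s)) l :
  (v *m A) 0 l != 0 -> exists2 j, v 0 j != 0 & A j l != 0.
Proof.
move=> vA; suff /existsP[j /andP[vj Aj]] : [exists j, (v 0 j != 0) && (A j l != 0)].
  by exists j.
apply: contraR vA; rewrite negb_exists => /forallP h; rewrite mxE big1 // => j _.
by move: (h j); rewrite negb_and !negbK => /orP[] /eqP ->; rewrite ?mul0r ?mulr0.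
Qed.

Lemma supp_coef U i (v : 'rV[k]_(rk F i.+1)) :
  downset U -> supp U (lb i.+1) v -> supp U (lb i) (v *m coef F i).
Proof.
move=> dU sv l /mulmx_neq0[j /sv Uj /(sr_graded res) lj]; exact: dU lj Uj.
Qed.

Definition acyclic_at U i := exact_at U (coef F i) (dout c i) (lb i.+1) (lb i).

(* In degree 0 the augmentation module is the ideal itself, whose part over a
   downset U is nonzero exactly when U contains a generator. *)
Definition supp_out U i : 'rV[k]_(dim_out F i) -> Prop :=
  match i return 'rV[k]_(dim_out F i) -> Prop with
  | 0 => fun z => z != 0 -> exists l, U (g l)
  | i'.+1 => fun z => supp U (lb i') z
  end.

Definition acyclic_below U i := if i is i'.+1 then acyclic_at U i' else True.

(** In positive degree the boundary is itself a cycle over U and is filled by acyclicity one degree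
    lower. In degree 0 a multiple of a preimage of a generator in U serves. *)
Lemma boundary_lift U i (v : 'rV[k]_(rk F i)) :
  downset U -> acyclic_below U i -> supp_out U (v *m dout c i) ->
  exists u, supp U (lb i) u /\ u *m dout c i = v *m dout c i.
Proof.
move=> dU; case: i v => [|i] v /= acU sv; last first.
  have [||u [su ->]] := acU (v *m coef F i) => //; last by exists u.
  by rewrite -mulmxA (sr_complex res) mulmx0.
have [-> | /sv[l Ul]] := eqVneq (v *m c) 0.
  by exists 0; rewrite mul0mx; split=> //; apply: supp0.
have [u [su uc]] := sr_onto res l; exists (((v *m c) 0 0) *: u).
rewrite -scalemxAl uc scalemx1 -mx11_scalar; split=> // j.
by rewrite mxE mulf_eq0 negb_or => /andP[_ /su lj]; apply: dU lj Ul.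
Qed.

Definition rest_row U r (la : 'I_r -> 'X_{1..n}) (v : 'rV[k]_r) : 'rV[k]_r :=
  \row_j (if U (la j) then v 0 j else 0).

Lemma supp_rest_row U r (la : 'I_r -> 'X_{1..n}) v : supp U la (rest_row U la v).
Proof. by move=> j; rewrite mxE; case: ifP; rewrite ?eqxx. Qed.

(** Only entries of v at label b reach label b in the next module, because U contains no other label
    divisible by b; as v is a cycle, they cancel there. In degree 0 a nonzero augmentation yields a
    generator dividing b, which is not b since b is no lcm of generators. *)
Lemma supp_out_top i U b (v : 'rV[k]_(rk F i)) :
  supp U (lb i) v -> v *m dout c i = 0 ->
  (forall j, U (lab F i j) -> mdiv b (lab F i j) -> lab F i j = b) ->
  lcm_below g b != b ->
  supp_out (sdivs b) (rest_row (pred1 b) (lb i) v *m dout c i).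
Proof.
case: i v => [|i] v /= sv vd top nb.
  case/rV0Pn=> l0 /mulmx_neq0[j /supp_rest_row /eqP jb].
  rewrite (ord1 l0) => /(sr_aug res)[l]; rewrite jb => lb; exists l.
  rewrite /sdivs lb; apply: contra nb => /eqP glb; apply/eqP/mdiv_anti.
    exact: lcm_below_mdiv.
  by rewrite -{1}glb mdiv_mlcm // inE.
move=> l nz; have [j /supp_rest_row /eqP jb jl] := mulmx_neq0 nz.
rewrite /sdivs -jb (sr_graded res jl) /=; apply: contra nz => /eqP lbE.
move/rowP/(_ l): vd; rewrite [RHS]mxE => vl0; apply/eqP.
rewrite -[RHS]vl0 !mxE; apply: eq_bigr => j' _; rewrite mxE /=.
case: eqVneq => // nj'; have [-> | vj'] := eqVneq (v 0 j') 0; first by rewrite mul0r.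
have [-> | /(sr_graded res) lj'] := eqVneq (coef F i j' l) 0; first by rewrite !mulr0.
by case/eqP: nj'; apply: top; [exact: sv | rewrite -jb -lbE].
Qed.

(* If b has maximal degree among the labels in U not dividing the top a, then
   the label-b part of a cycle v is, modulo a boundary from the strand at b,
   supported strictly below b: its boundary lies over the smaller downset of
   proper divisors of b, topped by the lcm of the generators dividing b. *)
Lemma acyclic_step i :
  (forall U, downset U -> topped g U -> acyclic_below U i) ->
  forall U, downset U -> topped g U -> acyclic_at U i.
Proof.
move=> IHi U dU [a [Ua aU]] v sv vd.
(* Induction on the number of basis elements over U whose label does not divide a; if there are
   none, v lies in the strand at a. *)
pose P U := [set j | U (lab F i j) && ~~ mdiv (lab F i j) a].
have [N] := ubnP #|P U|; elim: N => // N IHN in U dU Ua aU v sv vd *.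
rewrite ltnS => cardU; have [P0 | [j0 j0P]] := set_0Vmem (P U).
  have [||w [sw vE]] := sr_exact res (b := a) (v := v) => //.
    move=> j /sv Uj; apply: contraT => nja.
    by have := in_set0 j; rewrite -P0 inE Uj nja.
  by exists w; split=> //; apply: supp_sub sw => x xa; apply: dU xa Ua.
have [j jP jmax] := arg_maxnP (fun j => mdeg (lab F i j)) j0P.
have : j \in P U by []; rewrite inE => /andP[Uj nja]; set b := lab F i j in Uj nja jmax.
have top j' : U (lab F i j') -> mdiv b (lab F i j') -> lab F i j' = b.
  move=> Uj' bj'; apply/esym/mdiv_mdeg_eq=> //; apply: jmax.
  suff : j' \in P U by []; rewrite inE Uj' /=.
  by apply: contra nja; apply: mdiv_trans.
have nb : lcm_below g b != b by apply: contra nja => /eqP <-; apply: aU.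
pose vb := rest_row (pred1 b) (lb i) v.
have [|||u [su ud]] := @boundary_lift (sdivs b) i vb.
- exact: downset_sdivs.
- by apply: IHi; [exact: downset_sdivs | exact: topped_sdivs].
- exact: supp_out_top top nb.
(* Dropping all multiples of b keeps a and removes j from [P]; the corrected cycle has no label b
   left, hence none divisible by b. *)
pose U' := [pred x | U x && ~~ mdiv b x].
have [||||||w1 [sw1 w1E]] := IHN U' _ _ _ (v - vb + u).
- move=> x y xy /= /andP[Uy nby]; rewrite (dU _ _ xy Uy).
  by apply: contra nby => /mdiv_trans; apply.
- by rewrite /= Ua nja.
- by move=> x /andP[/aU].
- apply: suppD.
    move=> j'; rewrite /vb !mxE /=.
    have [_ | nj'] := eqVneq (lab F i j') b; first by rewrite subrr eqxx.
    rewrite subr0 => /sv Uj'; rewrite Uj' /=; apply: contra nj' => /top -> //.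
  apply: supp_sub su => x /andP[xb nxb]; rewrite /= (dU _ _ xb Uj).
  by apply: contra nxb => bx; rewrite (mdiv_anti xb bx).
- by rewrite mulmxDl mulmxBl vd ud addrNK.
- apply: leq_trans cardU; apply: proper_card; apply/properP; split.
    by apply/subsetP=> x; rewrite !inE /= => /andP[/andP[-> _]].
  by exists j => //; rewrite inE /= mdiv_refl andbF.
have [||w2 [sw2 w2E]] := sr_exact res (b := b) (v := vb - u).
- apply: suppD.
    by move=> j' /supp_rest_row /eqP ->; apply: mdiv_refl.
  by apply: suppN; apply: supp_sub su => x /andP[].
- by rewrite mulmxBl ud subrr.
exists (w1 + w2); split; last by rewrite mulmxDl -w1E -w2E -addrA [u + _]addrC !subrK.
apply: suppD; first by apply: supp_sub sw1 => x /andP[].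
by apply: supp_sub sw2 => x xb; apply: dU xb Uj.
Qed.

Lemma acyclic_topped U i : downset U -> topped g U -> acyclic_at U i.
Proof.
by elim: i U => [|i IHi] U dU tU; apply: acyclic_step.
Qed.

Lemma acyclic_empty U i : (forall x, ~~ U x) -> acyclic_at U i.
Proof.
move=> U0 v sv _; exists 0; rewrite mul0mx; split; first exact: supp0.
by apply/rowP=> j; rewrite mxE; apply: contraTeq isT => /sv; rewrite (negPf (U0 _)).
Qed.

Definition acyclic U := forall i, acyclic_at U i.

Lemma acyclic_divs b : acyclic (divs b).
Proof. by move=> i; apply: (sr_exact res). Qed.

(** A chain over [U'] with the same boundary is subtracted from v, the difference is filled over U,
    and the filling is cut down to labels outside [U'], which changes its boundary only over
    [U']. *)
Lemma acyclic_quotient U U' i (v : 'rV[k]_(rk F i)) :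
  downset U -> downset U' -> (forall x, U' x -> U x) ->
  acyclic U -> acyclic U' ->
  supp [pred x | U x && ~~ U' x] (lb i) v -> supp_out U' (v *m dout c i) ->
  exists w, supp [pred x | U x && ~~ U' x] (lb i.+1) w /\
            supp U' (lb i) (v - w *m coef F i).
Proof.
move=> dU dU' U'U acU acU' sv svd.
have [|||u [su ud]] := @boundary_lift U' i v => //.
  by case: (i) => // i'; apply: acU'.
have [||w [sw wE]] := acU i (v - u).
- apply: suppD; first by apply: supp_sub sv => x /andP[].
  by apply: suppN; apply: supp_sub su.
- by rewrite mulmxBl ud subrr.
exists (rest_row (predC U') (lb i.+1) w); split.
  by move=> j; rewrite mxE /=; case: ifP; rewrite ?eqxx // => U'j /sw ->.
rewrite -[v](subrK u) wE addrAC -mulmxBl; apply: suppD => //.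
apply: supp_coef => // j; rewrite !mxE /=; case: ifP; rewrite ?subrr ?eqxx //.
by move/negbFE.
Qed.

End Acyclicity.

(** * Relabeling and labels outside the lcm lattice *)

Section Relabeling.
Variables (k : fieldType) (n q : nat) (g : 'I_q -> 'X_{1..n}).
Implicit Types (U : pred 'X_{1..n}) (a b x y : 'X_{1..n}).
Local Open Scope ring_scope.

Definition lcm_closed : pred 'X_{1..n} :=
  fun x => (gens_below g x != set0) && (lcm_below g x == x).

Lemma lcm_closedP x : reflect (inLCM g x) (lcm_closed x).
Proof.
apply: (iffP andP) => [[nz /eqP xE] | [S [nz ->]]].
  by exists (gens_below g x); rewrite -[x in x = _]xE.
have SS : S \subset gens_below g (mlcm_over g S).
  by apply/subsetP=> l lS; rewrite inE mdiv_mlcm.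
split; first by apply: contra nz => /eqP S0; rewrite -subset0 -S0.
by apply/eqP/mdiv_anti; [exact: lcm_below_mdiv | exact: mdiv_mlcmS].
Qed.

Lemma lcm_closed_gen l : lcm_closed (g l).
Proof.
apply/lcm_closedP; exists [set l]; rewrite mlcm_over1; split=> //.
by apply/set0Pn; exists l; rewrite inE.
Qed.

Lemma lcm_below_eq x y :
  gens_below g x = gens_below g y -> lcm_below g x = lcm_below g y.
Proof. by rewrite /lcm_below => ->. Qed.

(** * Exact subquotients away from the lcm lattice *)

Section Cells.
Variables (F : mcomplex k n) (c : 'cV[k]_(rk F 0)).
Hypothesis res : strand_resolution g c.
Local Notation lb i := (@lab _ _ F i).

Lemma acyclic_no_gens U :
  downset U -> (forall x, U x -> gens_below g x = set0) -> acyclic c U.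
Proof.
move=> dU U0 i; have [Uz | nUz] := boolP (U 0%MM).
  apply: (acyclic_topped res) => //; exists 0%MM; split=> // x /U0.
  by rewrite /lcm_below => ->; rewrite mlcm_over0 mdiv_refl.
apply: acyclic_empty => x; apply: contra nUz; apply: dU; exact: mdiv0m.
Qed.

Lemma acyclic_sdivs b : ~~ lcm_closed b -> acyclic c (sdivs b).
Proof.
move=> nb; have [S0 | nS] := eqVneq (gens_below g b) set0.
  apply: acyclic_no_gens (@downset_sdivs _ b) _ => x /andP[xb _].
  by apply/eqP; rewrite -subset0 -S0 gens_belowS.
move=> i; apply: (acyclic_topped res); first exact: downset_sdivs.
by apply: topped_sdivs; move: nb; rewrite /lcm_closed nS.
Qed.

(* The labels in U but not in U' then carry an exact subquotient of F. *)
Definition cell U U' :=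
  [/\ downset U, downset U', (forall x, U' x -> U x), acyclic c U /\ acyclic c U'
    & forall x, U x -> lcm_closed x -> U' x].

(** In degree 0 every vector is a relative cycle: a generator dividing a label in U is lcm-closed,
    hence in [U'], so the augmentation takes values over [U']. *)
Definition cell_cycle (K : pred 'X_{1..n}) i : 'rV[k]_(dim_out F i) -> Prop :=
  match i return 'rV[k]_(dim_out F i) -> Prop with
  | 0 => fun=> True
  | i'.+1 => fun z => forall l, K (lab F i' l) -> z 0 l = 0
  end.

Lemma cell_exact U U' i (v : 'rV[k]_(rk F i)) :
  let K := [pred x | U x && ~~ U' x] in
  cell U U' -> supp K (lb i) v -> cell_cycle K (v *m dout c i) ->
  exists w, supp K (lb i.+1) w /\
            forall l, K (lab F i l) -> v 0 l = (w *m coef F i) 0 l.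
Proof.
move=> K [dU dU' U'U [acU acU'] clU] sv vK.
have [|w [sw vw]] := acyclic_quotient res dU dU' U'U acU acU' sv.
  case: i v sv vK => [|i] v sv vK /=.
    case/rV0Pn=> l0 /mulmx_neq0[j /sv /andP[Uj _]].
    rewrite (ord1 l0) => /(sr_aug res)[l lj].
    by exists l; apply: clU (lcm_closed_gen l); apply: dU lj Uj.
  move=> l nz; have sUv : supp U (lb i.+1) v by apply: supp_sub sv => x /andP[].
  have Ul := supp_coef res dU sUv nz.
  by apply: contraNT nz => nU'l; apply/eqP/vK; rewrite /= Ul.
exists w; split=> // l /andP[_ nU'l]; apply/eqP; rewrite -subr_eq0.
by apply: contraNT nU'l => nz; apply: vw; rewrite !mxE in nz *.
Qed.

Lemma cell_divs b : ~~ lcm_closed b -> cell (divs b) (sdivs b).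
Proof.
move=> nb; split; first exact: downset_divs.
- exact: downset_sdivs.
- by move=> x /andP[].
- by split; [exact: (acyclic_divs res) | exact: acyclic_sdivs].
by move=> x xb clx; rewrite /sdivs [mdiv _ _]xb; apply: contra nb => /eqP <-.
Qed.

Lemma cell_divsE b x : (divs b x && ~~ sdivs b x) = (x == b).
Proof.
rewrite /divs /sdivs negb_and negbK andb_orr andbN /=.
by case: eqVneq => [-> | _]; rewrite ?mdiv_refl ?andbF.
Qed.

(** For b outside the lcm lattice, the labels equal to b form an exact cell. Minimality kills all
    coefficients between equal labels, so a basis element of label b would be a cycle there but no
    boundary. *)
Lemma minimal_lcm_closed :
  (forall i j l, coef F i j l != 0 -> lab F i.+1 j != lab F i l) ->
  forall i j, lcm_closed (lab F i j).
Proof.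
move=> minF i j; apply: contraT => nb; set b := lab F i j in nb.
have [||w [sw wE]] := @cell_exact (divs b) (sdivs b) i (delta_mx 0 j) (cell_divs nb).
- move=> j'; rewrite mxE eqxx /=; have [-> _ | _] := eqVneq j' j; last by rewrite eqxx.
  by rewrite -/b cell_divsE.
- rewrite /b; case: (i) j {nb b} => // i' j l /=; rewrite cell_divsE => /eqP lE.
  apply: contraTeq isT => /mulmx_neq0[j']; rewrite mxE eqxx /=.
  by have [-> _ /minF | _] := eqVneq j' j; rewrite ?lE eqxx.
have : (delta_mx 0 j : 'rV[k]_(rk F i)) 0 j != 0 by rewrite mxE !eqxx oner_neq0.
rewrite wE; last by rewrite /= cell_divsE.
case/mulmx_neq0=> j' /sw.
by rewrite /= cell_divsE => /eqP j'b /minF; rewrite j'b eqxx.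
Qed.

(** [U] collects the monomials whose generators lie in S, and [U'] gives up those with exactly S,
    except their lcm a. For nonempty S both are topped by a. *)
Lemma cell_gens b : ~~ lcm_closed b ->
  exists U U', cell U U' /\ forall x,
    ~~ lcm_closed x && (gens_below g x == gens_below g b) = U x && ~~ U' x.
Proof.
move=> nb; pose S := gens_below g b; pose a := mlcm_over g S.
pose U := [pred x | gens_below g x \subset S].
pose U' := [pred x | U x && ((gens_below g x == S) ==> lcm_closed x)].
have gS x y : mdiv x y -> U y -> U x.
  by move=> xy; apply: subset_trans; apply: gens_belowS.
have aS : gens_below g a = S by apply: gens_below_lcm.
have dU' : downset U'.
  move=> x y xy /andP[Uy /implyP cly]; apply/andP; split; first exact: gS xy Uy.
  apply/implyP=> /eqP xS.
  have yS : gens_below g y = S.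
    by apply/eqP; rewrite eqEsubset [_ \subset S]Uy -xS gens_belowS.
  have := cly; rewrite yS eqxx => /(_ isT) cl; have /andP[_ /eqP yE] := cl.
  suff -> : x = y by [].
  apply: mdiv_anti => //; rewrite -yE (lcm_below_eq (y := x)) ?xS //.
  exact: lcm_below_mdiv.
exists U, U'; split.
  split=> //.
  - by move=> x /andP[].
  - split=> i.
      apply: (acyclic_topped res) => //; exists a; rewrite /= aS; split=> // x xS.
      exact: mdiv_mlcmS.
    (* For empty S, a is 1 and not lcm-closed, and [U'] is empty. *)
    have [S0 | nS] := eqVneq S set0.
      apply: acyclic_empty => x; apply/negP => /andP[xS /implyP clx].
      have {}xS : gens_below g x == S by rewrite S0 -subset0 -S0.
      by have := clx xS; rewrite /lcm_closed (eqP xS) S0 eqxx.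
    apply: (acyclic_topped res) => //; exists a; rewrite /= aS eqxx /= subxx.
    split; last by move=> x /andP[xS _]; apply: mdiv_mlcmS.
    by rewrite /lcm_closed aS nS /lcm_below aS; apply/eqP.
  by move=> x /= -> ->; rewrite implybT.
move=> x; rewrite /= negb_and; case: (boolP (_ \subset _)) => [_ | nxS] /=.
  by rewrite negb_imply andbC.
by rewrite andbC; apply/negbTE; apply: contra nxS => /andP[/eqP ->].
Qed.

End Cells.

(** * Relabeling along preserved divisibility relations *)

Section Transfer.
Variables (m : nat) (h : 'I_q -> 'X_{1..m}).
Hypothesis gh : forall l (B : {set 'I_q}), B != set0 ->
  mdiv (g l) (mlcm_over g B) -> mdiv (h l) (mlcm_over h B).

Definition relabeling x : 'X_{1..m} := mlcm_over h (gens_below g x).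

Lemma relabelingS x y : mdiv x y -> mdiv (relabeling x) (relabeling y).
Proof. by move=> xy; apply/mdiv_mlcmS/gens_belowS. Qed.

Lemma relabeling_lcm (S : {set 'I_q}) :
  S != set0 -> relabeling (mlcm_over g S) = mlcm_over h S.
Proof.
move=> nS; apply: mdiv_anti; first by apply/mlcm_overP=> l; rewrite inE; apply: gh.
by apply: mdiv_mlcmS; apply/subsetP=> l lS; rewrite inE mdiv_mlcm.
Qed.

Lemma relabeling_gen l : relabeling (g l) = h l.
Proof.
rewrite -(mlcm_over1 g) relabeling_lcm ?mlcm_over1 //.
by apply/set0Pn; exists l; rewrite inE.
Qed.

Lemma relabel_strand_resolution (F : mcomplex k n) (c : 'cV[k]_(rk F 0)) :
  strand_resolution g c ->
  @strand_resolution k m q h (relabel relabeling F) c.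
Proof.
move=> res; have grF := sr_graded res; split.
- by move=> i j l /grF lj; apply: relabelingS.
- by move=> j /(sr_aug res)[l lj]; exists l; rewrite mdiv_mlcm // inE.
- by case=> [|i]; [exact: (sr_complex res 0) | exact: (sr_complex res i.+1)].
- pose f := relabeling.
  have ac d : acyclic c [pred x | mdiv (f x) d].
    have dU : downset [pred x | mdiv (f x) d].
      by move=> x y xy; apply: mdiv_trans; apply: relabelingS.
    (* If S is nonempty, the lcm of the corresponding generators [g l] tops the downset of monomials
       relabeled to divisors of d; otherwise that downset meets no generator. *)
    pose S := [set l | mdiv (h l) d].
    have US x : mdiv (f x) d -> gens_below g x \subset S.
      by move=> /mlcm_overP xd; apply/subsetP=> l /xd; rewrite inE.
    have [S0 | nS] := eqVneq S set0.
      by apply: (acyclic_no_gens res) => // x /US; rewrite S0 subset0 => /eqP.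
    move=> i; apply: (acyclic_topped res) => //; exists (mlcm_over g S).
    split; last by move=> x /US; apply: mdiv_mlcmS.
    by rewrite /= /f relabeling_lcm //; apply/mlcm_overP=> l; rewrite inE.
  by case=> [|i] d; [exact: (ac d 0) | exact: (ac d i.+1)].
move=> l; have [v [sv vc]] := sr_onto res l; exists v; split=> // j /sv lj.
by rewrite /divs -relabeling_gen; apply: relabelingS.
Qed.

End Transfer.
End Relabeling.

(** * Ranks of reduced differentials *)

Section MaskedRank.
Variable k : fieldType.
Local Open Scope ring_scope.

Definition maskmx r s (t : pred 'I_r) (u : pred 'I_s) (A : 'M[k]_(r, s)) :
    'M[k]_(r, s) :=
  \matrix_(j, l) (if t j && u l then A j l else 0).

(** A is block triangular: t and u select a subcomplex, their complements the quotient. *)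
Definition maskcl r s (t : pred 'I_r) (u : pred 'I_s) (A : 'M[k]_(r, s)) :=
  forall j l, A j l != 0 -> t j -> u l.

Definition vsupp r (t : pred 'I_r) (v : 'rV[k]_r) := forall j, v 0 j != 0 -> t j.

Definition vmask r (t : pred 'I_r) (v : 'rV[k]_r) : 'rV[k]_r :=
  \row_j (if t j then v 0 j else 0).

Definition projmx r (t : pred 'I_r) : 'M[k]_r := diag_mx (\row_j (t j)%:R).

Lemma mulmx_projmx p r (t : pred 'I_r) (A : 'M[k]_(p, r)) :
  A *m projmx t = maskmx predT t A.
Proof.
apply/matrixP=> i j; rewrite mul_mx_diag !mxE /=.
by case: (t j); rewrite ?mulr1 ?mulr0.
Qed.

Lemma projmx_mulmx p r (t : pred 'I_r) (A : 'M[k]_(r, p)) :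
  projmx t *m A = maskmx t predT A.
Proof.
apply/matrixP=> i j; rewrite mul_diag_mx !mxE /= andbT.
by case: (t i); rewrite ?mul1r ?mul0r.
Qed.

Lemma vmaskE r (t : pred 'I_r) (v : 'rV[k]_r) : vmask t v = v *m projmx t.
Proof. by rewrite mulmx_projmx; apply/rowP=> j; rewrite !mxE. Qed.

Lemma vsuppP r (t : pred 'I_r) (v : 'rV[k]_r) :
  vsupp t v <-> v = vmask t v.
Proof.
split=> [sv | -> j]; last by rewrite mxE; case: (t j); rewrite ?eqxx.
apply/rowP=> j; rewrite mxE; case: ifPn => // ntj; apply/eqP.
by apply: contraNT ntj => /sv.
Qed.

Lemma vsuppNP r (t : pred 'I_r) (v : 'rV[k]_r) :
  vsupp t v <-> vmask (predC t) v = 0.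
Proof.
split=> [sv | v0 j].
  apply/rowP=> j; rewrite !mxE /=; case: ifPn => // ntj; apply/eqP.
  by apply: contraNT ntj => /sv.
by apply: contraNT => ntj; move/rowP/(_ j): v0; rewrite !mxE /= ntj => ->.
Qed.

Lemma vmask_split r (t : pred 'I_r) (v : 'rV[k]_r) :
  v = vmask t v + vmask (predC t) v.
Proof. by apply/rowP=> j; rewrite !mxE /=; case: (t j); rewrite ?addr0 ?add0r. Qed.

Section Closed.
Variables (r s : nat) (t : pred 'I_r) (u : pred 'I_s) (A : 'M[k]_(r, s)).
Hypothesis clA : maskcl t u A.

Lemma maskmx_sub : maskmx t u A = projmx t *m A.
Proof.
rewrite projmx_mulmx; apply/matrixP=> j l; rewrite !mxE andbT.
case: ifPn; first by case/andP=> ->.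
rewrite negb_and; case: (boolP (t j)) => //= tj nul; apply/esym/eqP.
by apply: contraNT nul => /clA ->.
Qed.

Lemma maskmx_quo : maskmx (predC t) (predC u) A = A *m projmx (predC u).
Proof.
rewrite mulmx_projmx; apply/matrixP=> j l; rewrite !mxE /=.
case: (boolP (t j)) => //= tj; case: ifP => // nul; apply/esym/eqP.
by apply: contraNT nul => /clA ->.
Qed.

(** The rank is that of the quotient block plus the dimension of the part of the image lying in the
    span of u. The hypothesis, vanishing of a connecting map, identifies that part with the image of
    the subcomplex block. *)
Lemma rank_mask_split :
  (forall w : 'rV_r, vsupp u (w *m A) -> (w *m A <= maskmx t u A)%MS) ->
  \rank A = (\rank (maskmx t u A) + \rank (maskmx (predC t) (predC u) A))%N.
Proof.
move=> hA; rewrite -(mxrank_mul_ker A (projmx (predC u))) -maskmx_quo addnC.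
congr (_ + _)%N; apply: eqmx_rank; apply/andP; split.
  apply/row_subP=> i; have := row_sub i (A :&: kermx (projmx (predC u)))%MS.
  rewrite sub_capmx => /andP[/submxP[w ->] /sub_kermxP wk].
  by apply: hA; apply/vsuppNP; rewrite vmaskE.
rewrite sub_capmx maskmx_sub submxMl; apply/sub_kermxP.
rewrite -maskmx_sub mulmx_projmx; apply/matrixP=> j l; rewrite !mxE /=.
by case: (u l); rewrite ?andbF.
Qed.

End Closed.

(** With the quotient exact in the middle, w can be moved into the subcomplex by subtracting a
    boundary, which leaves its image unchanged. *)
Lemma vsupp_quotient r2 r1 r0 (t2 : pred 'I_r2) (t1 : pred 'I_r1)
    (t0 : pred 'I_r0) (B : 'M[k]_(r2, r1)) (A : 'M[k]_(r1, r0)) :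
  maskcl t1 t0 A -> maskcl t2 t1 B -> B *m A = 0 ->
  (forall v, vsupp (predC t1) v -> v *m maskmx (predC t1) (predC t0) A = 0 ->
     (v <= maskmx (predC t2) (predC t1) B)%MS) ->
  forall w : 'rV_r1, vsupp t0 (w *m A) -> (w *m A <= maskmx t1 t0 A)%MS.
Proof.
move=> clA clB BA ex w sw; have {}sw := (vsuppNP _ _).1 sw.
have [||x xE] := submxP (ex (vmask (predC t1) w) _ _).
- by apply/vsuppP; apply/rowP=> j; rewrite !mxE; case: ifP.
- have := vmask_split t1 w => wE; move: sw.
  rewrite {1}wE vmaskE !(maskmx_quo clA) !mulmxDl -!mulmxA.
  suff -> : vmask t1 w *m (A *m projmx (predC t0)) = 0 by rewrite add0r.
  rewrite vmaskE -mulmxA [projmx t1 *m _]mulmxA -(maskmx_sub clA).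
  rewrite mulmx_projmx.
  suff -> : maskmx predT (predC t0) (maskmx t1 t0 A) = 0 by rewrite mulmx0.
  by apply/matrixP=> j l; rewrite !mxE /=; case: (t0 l); rewrite ?andbF.
move: xE; rewrite (maskmx_quo clB) mulmxA -vmaskE => xE.
have -> : w *m A = (w - x *m B) *m A by rewrite mulmxBl -mulmxA BA mulmx0 subr0.
suff -> : w - x *m B = vmask t1 (w - x *m B).
  by rewrite vmaskE -mulmxA -(maskmx_sub clA) submxMl.
apply/vsuppP/vsuppNP; rewrite vmaskE mulmxBl -!vmaskE -xE.
by rewrite subrr.
Qed.

Lemma vsupp_sub r2 r1 r0 (t1 : pred 'I_r2) (t0 : pred 'I_r1)
    (tm : pred 'I_r0) (A : 'M[k]_(r2, r1)) (C : 'M[k]_(r1, r0)) :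
  A *m C = 0 ->
  (forall v, vsupp t0 v -> v *m maskmx t0 tm C = 0 -> (v <= maskmx t1 t0 A)%MS) ->
  forall w : 'rV_r2, vsupp t0 (w *m A) -> (w *m A <= maskmx t1 t0 A)%MS.
Proof.
move=> AC0 ex w; have : (w *m A) *m C = 0 by rewrite -mulmxA AC0 mulmx0.
move: (w *m A) => v vC sv; apply: ex => //; apply/rowP=> l; rewrite [RHS]mxE.
have [tml | ntml] := boolP (tm l); last first.
  by rewrite mxE big1 // => j _; rewrite !mxE (negPf ntml) andbF mulr0.
move/rowP/(_ l): vC; rewrite !mxE => vC; rewrite -[RHS]vC; apply: eq_bigr => j _.
rewrite !mxE tml andbT; case: ifPn => // ntj.
suff -> : v 0 j = 0 by rewrite !mul0r.
by apply/eqP; apply: contraNT ntj => /sv.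
Qed.

Lemma rank_exact r2 r1 r0 (t1 : pred 'I_r1) (D : 'M[k]_(r2, r1))
    (E : 'M[k]_(r1, r0)) :
  projmx t1 *m E = E -> D *m projmx t1 = D -> D *m E = 0 ->
  (forall v, vsupp t1 v -> v *m E = 0 -> (v <= D)%MS) ->
  (\rank D + \rank E)%N = \rank (projmx t1).
Proof.
move=> pE Dp DE ex; rewrite -(mxrank_mul_ker (projmx t1) E) pE addnC.
congr (_ + _)%N; apply: eqmx_rank; apply/andP; split.
  by rewrite sub_capmx -{1}Dp submxMl; apply/sub_kermxP.
apply/row_subP=> i; have := row_sub i (projmx t1 :&: kermx E)%MS.
rewrite sub_capmx => /andP[/submxP[w wE] /sub_kermxP vE]; apply: ex => //.
by apply/vsuppP; rewrite wE -vmaskE; apply/rowP=> j; rewrite !mxE; case: ifP.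
Qed.

End MaskedRank.

(** * Block differentials and their ranks *)

Section Blocks.
Variables (k : fieldType) (n q : nat) (g : 'I_q -> 'X_{1..n}).
Variables (F : mcomplex k n) (c : 'cV[k]_(rk F 0)).
Hypothesis res : strand_resolution g c.
Implicit Types (P : pred 'X_{1..n}) (b x y : 'X_{1..n}).
Local Open Scope ring_scope.
Local Notation cl := (lcm_closed g).

Definition on_lab P i : pred 'I_(rk F i) := fun j => P (lab F i j).

Section Key.
Variables (T : eqType) (key : 'X_{1..n} -> T).

(** Key [id] gives [redmat], and key [relabeling] the [redmat] of the relabeled complex; they are
    compared through the key [gens_below]. *)
Definition blockmx i : 'M[k]_(rk F i.+1, rk F i) :=
  \matrix_(j, l)
    (if key (lab F i.+1 j) == key (lab F i l) then coef F i j l else 0).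

Definition pblockmx P i := maskmx (@on_lab P i.+1) (@on_lab P i) (blockmx i).

Definition pblock_out P i : 'M[k]_(rk F i, dim_out F i) :=
  match i return 'M[k]_(rk F i, dim_out F i) with
  | 0 => 0
  | i'.+1 => pblockmx P i'
  end.

Definition key_convex P := forall x y z, mdiv x y -> mdiv y z ->
  P x -> P z -> key x = key z -> P y /\ key y = key x.

Definition key_cells P := forall b, P b -> exists U U',
  cell g c U U' /\ forall x, P x && (key x == key b) = U x && ~~ U' x.

Lemma pblockmxE P i j l : pblockmx P i j l =
  if [&& P (lab F i.+1 j), P (lab F i l) & key (lab F i.+1 j) == key (lab F i l)]
  then coef F i j l else 0.
Proof.
by rewrite !mxE /on_lab andbA; case: (P _ && P _) => //; rewrite ?if_same.
Qed.

Lemma pblockmx_predT i : pblockmx predT i = blockmx i.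
Proof. by apply/matrixP=> j l; rewrite !mxE. Qed.

Lemma pblockmx_complex P i :
  key_convex P -> pblockmx P i.+1 *m pblockmx P i = 0.
Proof.
move=> cvx; apply/matrixP=> j t; rewrite mxE [RHS]mxE.
pose K := [&& P (lab F i.+2 j), P (lab F i t) & key (lab F i.+2 j) == key (lab F i t)].
(* By convexity, whether a nonzero term survives depends only on the outer labels, not on l. *)
have termE l : pblockmx P i.+1 j l * pblockmx P i l t =
    if K then coef F i.+1 j l * coef F i l t else 0.
  rewrite !pblockmxE; have [-> | jl] := eqVneq (coef F i.+1 j l) 0.
    by rewrite !if_same !mul0r if_same.
  have [-> | lt] := eqVneq (coef F i l t) 0; first by rewrite !if_same !mulr0 if_same.
  have dl := sr_graded res jl; have dt := sr_graded res lt.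
  have [/and3P[Pj Pt /eqP jt] | nK] := boolP K.
    have [Pl lE] := cvx _ _ _ dt dl Pt Pj (esym jt).
    by rewrite Pj Pl Pt lE jt !eqxx.
  case: ifP => [/and3P[Pj Pl /eqP jlE]|]; last by rewrite mul0r.
  case: ifP => [/and3P[_ Pt /eqP ltE]|]; last by rewrite mulr0.
  by case/negP: nK; rewrite /K Pj Pt jlE ltE eqxx.
rewrite (eq_bigr _ (fun l _ => termE l)); case: K {termE}; last by rewrite big1.
by have /matrixP/(_ j t) := sr_complex res i.+1; rewrite !mxE.
Qed.

Definition key_part i (v : 'rV[k]_(rk F i)) (t : T) : 'rV[k]_(rk F i) :=
  \row_j (if key (lab F i j) == t then v 0 j else 0).

(** The block differential preserves keys, so v splits by key; each part is a relative cycle of one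
    cell and is filled by [cell_exact]. *)
Lemma pblockmx_exact P i (v : 'rV[k]_(rk F i)) : key_cells P ->
  vsupp (@on_lab P i) v -> v *m pblock_out P i = 0 -> (v <= pblockmx P i)%MS.
Proof.
move=> cells sv vd.
pose keys := undup [seq key (lab F i j) | j <- enum 'I_(rk F i)].
have -> : v = \sum_(t <- keys) key_part v t.
  apply/rowP=> j; rewrite summxE (bigD1_seq (key (lab F i j))) ?undup_uniq //=.
    rewrite mxE eqxx big1 ?addr0 // => t ntj.
    by rewrite mxE eq_sym (negPf ntj).
  by rewrite mem_undup; apply: (map_f (fun j => key (lab F i j))); rewrite mem_enum.
rewrite big_seq; apply: summx_sub => t _.
have [-> | /rV0Pn[j pj]] := eqVneq (key_part v t) 0; first exact: sub0mx.
have partE j' : key_part v t 0 j' = if key (lab F i j') == t then v 0 j' else 0.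
  by rewrite mxE.
have partP j' : key_part v t 0 j' != 0 -> P (lab F i j') && (key (lab F i j') == t).
  by rewrite mxE; case: ifP => [_ /sv Pj' | _]; [rewrite andbT | rewrite eqxx].
have /andP[Pj /eqP jt] := partP j pj.
have [U [U' [cUU' KE]]] := cells _ Pj; rewrite jt in KE.
have [||w [sw wE]] := cell_exact res (v := key_part v t) cUU'.
- by move=> j' /partP; rewrite /= KE.
- move: (key_part v t) partE {partP j pj Pj jt} => u uE.
  case: (i) v sv vd u uE => // i' v sv vd u uE l.
  rewrite /= -KE => /andP[Pl /eqP lt].
  have /rowP/(_ l) := vd; rewrite /= [RHS]mxE => vd0; rewrite -[RHS]vd0 !mxE.
  apply: eq_bigr => j _; rewrite pblockmxE uE Pl lt.
  have [-> | /sv] := eqVneq (v 0 j) 0; first by rewrite if_same !mul0r.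
  by rewrite /on_lab => ->; case: ifP; rewrite ?mul0r ?mulr0.
suff -> : key_part v t = w *m pblockmx P i by apply: submxMl.
apply/rowP=> l; have [Kl | nKl] := boolP (U (lab F i l) && ~~ U' (lab F i l)).
  rewrite wE // !mxE; apply: eq_bigr => j' _; rewrite pblockmxE.
  have [-> | /sw] := eqVneq (w 0 j') 0; first by rewrite !mul0r.
  rewrite -KE in Kl; rewrite /= -KE; case/andP: Kl => -> /eqP ->.
  by case/andP=> -> ->.
rewrite [RHS]mxE [LHS](_ : _ = 0); last first.
  by apply/eqP; apply: contraNT nKl => /partP; rewrite KE.
rewrite big1 // => j' _; rewrite pblockmxE.
have [-> | /sw] := eqVneq (w 0 j') 0; first by rewrite mul0r.
rewrite /= -KE => /andP[Pj' /eqP j't]; case: ifP; rewrite ?mulr0 // j't.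
by case/and3P=> _ Pl lt; rewrite -KE Pl eq_sym lt in nKl.
Qed.

Lemma rank_pblock P i : key_convex P -> key_cells P ->
  (\rank (pblockmx P i) + \rank (pblock_out P i))%N = \rank (projmx k (@on_lab P i)).
Proof.
move=> cvx cells; apply: rank_exact.
- case: i => [|i] /=; first by rewrite mulmx0.
  rewrite projmx_mulmx; apply/matrixP=> j l; rewrite !mxE andbT.
  by case: (on_lab _ _).
- rewrite mulmx_projmx; apply/matrixP=> j l; rewrite !mxE /=.
  by case: (on_lab _ l); rewrite ?andbF.
- by case: i => [|i] /=; [rewrite mulmx0 | apply: pblockmx_complex].
by move=> v; apply: pblockmx_exact.
Qed.

Hypothesis key_mono : key_convex predT.

Lemma blockmx_complex i : blockmx i.+1 *m blockmx i = 0.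
Proof. by rewrite -!pblockmx_predT; apply: pblockmx_complex. Qed.

Definition key_closed P := forall x y, mdiv x y -> key x = key y -> P y -> P x.

Lemma maskcl_block P i :
  key_closed P -> maskcl (@on_lab P i.+1) (@on_lab P i) (blockmx i).
Proof.
move=> clP j l; rewrite mxE.
have [jl | _] := eqVneq (key (lab F i.+1 j)) (key (lab F i l)); last by rewrite eqxx.
by move=> /(sr_graded res) lj; apply: clP lj (esym jl).
Qed.

(** P spans a subcomplex with exact quotient, which makes the connecting map vanish; in
    [rank_block_sub] the subcomplex is the exact one. *)
Lemma rank_block_quo P i : key_closed P -> key_cells (predC P) ->
  \rank (blockmx i) = (\rank (pblockmx P i) + \rank (pblockmx (predC P) i))%N.
Proof.
move=> clP cells; apply: rank_mask_split; first exact: maskcl_block.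
apply: vsupp_quotient (maskcl_block (i := i.+1) clP) (blockmx_complex i) _.
  exact: maskcl_block.
by move=> v sv vd; apply: (pblockmx_exact (i := i.+1) cells).
Qed.

Lemma rank_block_sub P i : key_closed P -> key_cells P ->
  \rank (blockmx i) = (\rank (pblockmx P i) + \rank (pblockmx (predC P) i))%N.
Proof.
move=> clP cells; apply: rank_mask_split; first exact: maskcl_block.
case: i => [|i].
  apply: (@vsupp_sub _ _ _ 1 (@on_lab P 1) (@on_lab P 0) predT _ 0).
    exact: mulmx0.
  by move=> v sv _; apply: (pblockmx_exact (i := 0)); rewrite ?mulmx0.
apply: (vsupp_sub (tm := @on_lab P i) (blockmx_complex i)) => v sv vd.
exact: (pblockmx_exact (i := i.+1) cells sv vd).
Qed.

End Key.

(** In an exact complex the ranks follow recursively from the dimensions, here the numbers of labels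
    in P, which are independent of the key. *)
Lemma rank_pblock_eq (T T' : eqType) (key : 'X_{1..n} -> T)
    (key' : 'X_{1..n} -> T') P i :
  key_convex key P -> key_cells key P -> key_convex key' P -> key_cells key' P ->
  \rank (pblockmx key P i) = \rank (pblockmx key' P i).
Proof.
move=> cvx cells cvx' cells'.
elim: i => [|i IHi].
  have /= := rank_pblock 0 cvx cells; rewrite -(rank_pblock 0 cvx' cells') /=.
  by rewrite !mxrank0 !addn0.
have /= := rank_pblock i.+1 cvx cells; rewrite -(rank_pblock i.+1 cvx' cells') /=.
by rewrite IHi => /addIn.
Qed.

(** A label in the lcm lattice is determined by the generators dividing it, so both keys give the
    same block there. The complement is exact for both, and [rank_pblock_eq] applies. *)
Lemma rank_redmat_gens i :
  \rank (redmat F i) = \rank (blockmx (gens_below g) i).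
Proof.
have -> : redmat F i = blockmx id i by [].
rewrite (@rank_block_quo _ id _ cl) ?(@rank_block_quo _ (gens_below g) _ cl) //.
- congr (_ + _)%N.
    congr (\rank _); apply/matrixP=> j l; rewrite !pblockmxE.
    case: (boolP (cl _)) => //= /andP[_ /eqP jE].
    case: (boolP (cl _)) => //= /andP[_ /eqP lE].
    suff -> : (lab F i.+1 j == lab F i l) =
      (gens_below g (lab F i.+1 j) == gens_below g (lab F i l)) by [].
    by apply/eqP/eqP=> [-> // | e]; rewrite -jE -lE; apply: lcm_below_eq.
  apply: rank_pblock_eq.
  + move=> x y z xy yz nx _ xz; have {xz}xz : x = z by [].
    by rewrite -xz in yz; rewrite -(mdiv_anti xy yz).
  + move=> b nb; exists (divs b), (sdivs b); split; first exact: cell_divs res _ nb.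
    by move=> x; rewrite cell_divsE; case: eqP => [-> | _]; rewrite ?andbF ?andbT.
  + move=> x y z xy yz nx nz xz; have yx := gens_below_mid xy yz xz; split=> //.
    apply: contra nx => cy; have /andP[_ /eqP yE] := cy.
    suff -> : x = y by [].
    apply: mdiv_anti => //; rewrite -yE (lcm_below_eq (y := x)) //.
    exact: lcm_below_mdiv.
  + by move=> b nb; apply: (cell_gens res nb).
- by move=> x y z xy yz _ _ xz; have := gens_below_mid xy yz xz.
- move=> x y xy xyE /andP[ny /eqP yE]; suff -> : x = y by rewrite /lcm_closed ny yE /=.
  apply: mdiv_anti => //; rewrite -yE -(lcm_below_eq xyE); exact: lcm_below_mdiv.
- by move=> b nb; apply: (cell_gens res nb).
- move=> x y z xy yz _ _ xz; have {xz}xz : x = z by [].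
  by rewrite -xz in yz; rewrite -(mdiv_anti xy yz).
- by move=> x y _ ->.
move=> b nb; exists (divs b), (sdivs b); split; first exact: cell_divs res _ nb.
by move=> x; rewrite cell_divsE; case: eqP => [-> | _]; rewrite ?andbF ?andbT.
Qed.

(** * Invariance of Betti numbers under relabeling *)

Section Betti.
Variables (m : nat) (h : 'I_q -> 'X_{1..m}).
Hypothesis gh : forall l (B : {set 'I_q}), B != set0 ->
  mdiv (g l) (mlcm_over g B) = mdiv (h l) (mlcm_over h B).

Lemma relabeling_inj x y : gens_below g x != set0 -> gens_below g y != set0 ->
  relabeling g h x = relabeling g h y -> gens_below g x = gens_below g y.
Proof.
move=> nx ny; rewrite /relabeling => xy.
suff sub u v : gens_below g v != set0 ->
    mlcm_over h (gens_below g u) = mlcm_over h (gens_below g v) ->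
    gens_below g u \subset gens_below g v.
  by apply/eqP; rewrite eqEsubset !sub.
move=> nv uv; apply/subsetP=> l lu; rewrite inE.
apply: mdiv_trans (lcm_below_mdiv g v); rewrite gh // -uv.
exact: mdiv_mlcm.
Qed.

(* Labels divisible by no generator are relabeled to 1, which is also the label
   of the atom of I when I = R; they are split off first. *)
Lemma rank_redmat_relabel i :
  \rank (redmat (relabel (relabeling g h) F) i) = \rank (redmat F i).
Proof.
have -> : redmat (relabel (relabeling g h) F) i = blockmx (relabeling g h) i by [].
pose E := [pred x | gens_below g x == set0].
have dE : downset E.
  by move=> x y xy /eqP y0; rewrite /= -subset0 -y0 gens_belowS.
have cellE : cell g c E pred0.
  split=> //; last by move=> x /eqP x0; rewrite /lcm_closed x0 eqxx.
  split; last by move=> i'; apply: acyclic_empty.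
  by apply: (acyclic_no_gens res) => // x /eqP.
rewrite rank_redmat_gens (@rank_block_sub _ (relabeling g h) _ E).
- rewrite (@rank_block_sub _ (gens_below g) _ E).
  + congr (_ + _)%N; congr (\rank _); apply/matrixP=> j l; rewrite !pblockmxE /=.
      case: eqP => //= jE; case: eqP => //= lE.
      by rewrite /relabeling jE lE !eqxx.
    case: (boolP (_ == set0)) => //= jE; case: (boolP (_ == set0)) => //= lE.
    suff -> : (relabeling g h (lab F i.+1 j) == relabeling g h (lab F i l)) =
      (gens_below g (lab F i.+1 j) == gens_below g (lab F i l)) by [].
    by apply/eqP/eqP=> [/relabeling_inj -> | ] //; rewrite /relabeling => ->.
  + by move=> x y z xy yz _ _ xz; have := gens_below_mid xy yz xz.
  + by move=> x y xy _; apply: dE.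
  move=> b /eqP bE; exists E, pred0; split=> // x; rewrite /= bE andbT.
  by case: eqP.
- move=> x y z xy yz _ _ xz; split=> //; apply: mdiv_anti.
    by rewrite xz; apply: relabelingS.
  exact: relabelingS.
- by move=> x y xy _; apply: dE.
move=> b /eqP bE; exists E, pred0; split=> // x; rewrite /= andbT /relabeling bE.
by case: eqP => //= ->; rewrite eqxx.
Qed.

Lemma homdim_relabel i : homdim (relabel (relabeling g h) F) i = homdim F i.
Proof.
by rewrite /homdim rank_redmat_relabel; case: i => // i; rewrite rank_redmat_relabel.
Qed.

End Betti.
End Blocks.

(** * Divisibility relations of the extremal ideal *)

Section ExtremalIdeal.
Variable q : nat.
Implicit Types (D : {set drel q}) (A B : {set 'I_q}).

(** All exponents are 0 or 1, so each variable y_A contributes one condition: if b is in A, some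
    member of B is. *)
Lemma mdiv_eps D b B :
  reflect (forall A, inQ D A -> b \in A -> A :&: B != set0)
          (mdiv (eps D b) (mlcm_over (eps D) B)).
Proof.
apply: (iffP (mdivP _ _)) => [h A QA bA | h i].
  have nA : A != set0 by case/andP: QA.
  have := h (enum_rank (Sub A nA : nesub q)); rewrite !mnmE /= enum_rankK /= QA bA.
  apply: contraTneq => AB; rewrite -ltnNge ltnS; apply/bigmax_leqP => l lB.
  rewrite mnmE /= enum_rankK /= QA /=; case: (boolP (l \in A)) => // lA.
  by have := in_set0 l; rewrite -AB inE lA lB.
rewrite !mnmE /=; set A := val _; case: (boolP (_ && _)) => // /andP[QA bA].
have /set0Pn[l /setIP[lA lB]] := h A QA bA.
apply: (@leq_trans (eps D l i)); last first.
  exact: (leq_bigmax_cond (F := fun l : 'I_q => eps D l i)) lB.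
by rewrite mnmE /= -/A QA lA.
Qed.

(** If the common element with the first set is the removed index [z.1], then A contains [z.1] and
    so meets the second set. *)
Lemma dcirc_meets D x A :
  dcirc D x -> inQ D A -> x.1 \in A -> A :&: x.2 != set0.
Proof.
move=> Dx QA; elim: Dx => [y yD | y z _ IHy _ IHz] /= xA.
  by case/andP: QA => _ /forall_inP/(_ y yD)/implyP; apply.
have /set0Pn[l /setIP[lA ly]] := IHy xA.
have [lz | nlz] := eqVneq l z.1; last first.
  by apply/set0Pn; exists l; rewrite !inE lA nlz ly.
have /set0Pn[l' /setIP[l'A l'z]] := IHz (etrans (congr1 _ (esym lz)) lA).
by apply/set0Pn; exists l'; rewrite !inE l'A l'z orbT.
Qed.

Lemma Dbar_mdiv_eps D b B :
  Dbar D (b, B) -> mdiv (eps D b) (mlcm_over (eps D) B).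
Proof.
case=> [[C [DC CB]] | /= bB]; apply/mdiv_eps => A QA bA.
  have /set0Pn[l /setIP[lA lC]] := dcirc_meets DC QA bA.
  by apply/set0Pn; exists l; rewrite inE lA (subsetP CB).
by apply/set0Pn; exists b; rewrite inE bA.
Qed.

(* For every variable x_i and exponent t, the generators whose x_i-exponent is
   at least t form a member of Q(D). *)
Lemma mdiv_eps_gens n (m : 'I_q -> 'X_{1..n}) D :
  (forall x, x \in D -> Div m x) -> forall b B,
  mdiv (eps D b) (mlcm_over (eps D) B) -> mdiv (m b) (mlcm_over m B).
Proof.
move=> Dm b B /mdiv_eps h; apply/mdivP=> i; rewrite mnmE.
have [-> // | t0] := posnP (m b i); pose A := [set l | m b i <= m l i].
have bA : b \in A by rewrite inE.
have QA : inQ D A.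
  apply/andP; split; first by apply/set0Pn; exists b.
  apply/forall_inP=> -[c C] /Dm [/= _ /mdivP/(_ i)]; rewrite mnmE => cC.
  apply/implyP; rewrite inE => bc; apply: contraTneq t0 => AC; rewrite -leqNgt.
  rewrite leqNgt; apply/negP => t0.
  (* If A misses C, all exponents over C are below [m b i], yet their maximum is at least [m c i],
     hence at least [m b i]. Positivity of [m b i] makes its predecessor a strict bound. *)
  have : m b i <= (m b i).-1.
    apply: leq_trans (leq_trans bc cC) _; apply/bigmax_leqP=> l lC.
    rewrite -ltnS prednK // ltnNge; apply/negP => bl.
    by have := in_set0 l; rewrite -AC !inE bl lC.
  by rewrite -ltnS prednK // ltnn.
have /set0Pn[l] := h A QA bA; rewrite !inE => /andP[bl lB].
apply: leq_trans bl _.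
exact: (leq_bigmax_cond (F := fun l : 'I_q => m l i)) lB.
Qed.

End ExtremalIdeal.

Theorem theorem4p5 (k : fieldType) (n q : nat) (m : 'I_q -> 'X_{1..n})
  (D : {set drel q}) :
  (0 < q)%N ->
  injective m -> minimal_gens m ->
  (forall x, x \in D -> Div m x) ->
  exists f : 'X_{1..nE q} -> 'X_{1..n},
    (* f : LCM(E_D) -> LCM(I) *)
    (forall a, inLCM (eps D) a -> inLCM m (f a)) /\
    (* bijective on the atoms *)
    (exists s : {perm 'I_q}, forall i, f (eps D i) = m (s i)) /\
    (* preserves lcms *)
    (forall a b, inLCM (eps D) a -> inLCM (eps D) b ->
        f (monlcm a b) = monlcm (f a) (f b)) /\
    (* relabeling the minimal resolution of E_D gives a resolution of I *)
    (forall F : mcomplex k (nE q),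
        is_minimal_resolution (eps D) F -> is_resolution m (relabel f F)) /\
    ((forall x, Dbar D x <-> Div m x) ->
       (* f is a lattice isomorphism LCM(E_D) -> LCM(I) *)
       ((forall a b, inLCM (eps D) a -> inLCM (eps D) b ->
           mdiv (f a) (f b) = mdiv a b) /\
        (forall c, inLCM m c -> exists a, inLCM (eps D) a /\ f a = c)) /\
       (forall F : mcomplex k (nE q),
          is_minimal_resolution (eps D) F ->
          is_minimal_resolution m (relabel f F)) /\
       (forall i b, betti k (eps D) i b <-> betti k m i b)).
Proof.
move=> _ _ _ Dm; set g := eps D.
have gh l (B : {set 'I_q}) : B != set0 ->
    mdiv (g l) (mlcm_over g B) -> mdiv (m l) (mlcm_over m B).
  by move=> _; apply: mdiv_eps_gens.
exists (relabeling g m); split; [|split; [|split; [|split]]].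
- by move=> _ [S [nS ->]]; exists S; rewrite (relabeling_lcm gh).
- by exists 1%g => i; rewrite perm1 (relabeling_gen gh).
- move=> _ _ [S [nS ->]] [T [nT ->]]; rewrite -mlcm_overU !(relabeling_lcm gh) //.
    exact: mlcm_overU.
  by apply: contra nS => /eqP ST; rewrite -subset0 -ST subsetUl.
- move=> F [/is_resolutionP[c res] _]; apply/is_resolutionP.
  by exists c; apply: relabel_strand_resolution.
move=> DbarE.
(* The relations in the closure of D always hold in the extremal ideal, so here both ideals have the
   same divisibility relations. *)
have ghE l (B : {set 'I_q}) : B != set0 ->
    mdiv (g l) (mlcm_over g B) = mdiv (m l) (mlcm_over m B).
  move=> nB; apply/idP/idP; first exact: gh.
  by move=> lB; apply/Dbar_mdiv_eps/DbarE.
split; [split | split].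
- move=> _ _ [S [nS ->]] [T [nT ->]]; rewrite !(relabeling_lcm gh) //.
  by apply/mlcm_overP/mlcm_overP=> h l /h; rewrite ghE.
- move=> _ [S [nS ->]]; exists (mlcm_over g S).
  by rewrite (relabeling_lcm gh) //; split=> //; exists S.
- move=> F [/is_resolutionP[c res] minF]; split.
    by apply/is_resolutionP; exists c; apply: relabel_strand_resolution.
  (* Labels of a minimal resolution lie in the lcm lattice, where the relabeling is injective, so
     distinct labels stay distinct. *)
  move=> i j l /minF; apply: contra => /eqP fjl; apply/eqP.
  have /andP[nj /eqP <-] := minimal_lcm_closed res minF j.
  have /andP[nl /eqP <-] := minimal_lcm_closed res minF l.
  exact: lcm_below_eq (relabeling_inj ghE nj nl fjl).
move=> i b; split=> -[F [/is_resolutionP[c res] <-]].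
  exists (relabel (relabeling g m) F); split; last exact: (homdim_relabel res ghE).
  by apply/is_resolutionP; exists c; apply: relabel_strand_resolution.
(* [ghE] is symmetric, so resolutions of I relabel back to resolutions of the extremal ideal. *)
exists (relabel (relabeling m g) F); split.
  apply/is_resolutionP; exists c; apply: relabel_strand_resolution => // l B nB.
  by rewrite ghE.
by apply: (homdim_relabel res) => l B nB; rewrite ghE.
Qed.
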